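(* Let $V=\mathbb{C}^n$, let $\boldsymbol\alpha=(\alpha^1,\dots,\alpha^m)$ be a list of Schubert conditions in $\binom{[n]}{k}$, and let $F^1_\bullet,\dots,F^m_\bullet$ be sufficiently general flags in $V$. The intersection $$X:=X^\circ_{\alpha^1}F^1_\bullet\cap\cdots\cap X^\circ_{\alpha^m}F^m_\bullet$$ is (via the dual diagonal map $\Delta^m$) the solution set of the system of bilinear equations $$M\,F^1\,\widehat F^{i}\,N_i=0_{k\times(n-k)},\qquad i=2,\dots,m,$$ in the unknowns $(M,N_2,\dots,N_m)\in \mathrm S_{\alpha^1}\times\widehat{\mathrm S}_{(\alpha^2)^\perp}\times\cdots\times\widehat{\mathrm S}_{(\alpha^m)^\perp}$; that is, $(M,N_2,\dots,N_m)\mapsto(\operatorname{rowspace}(MF^1),\operatorname{colspace}(\widehat F^2N_2),\dots,\operatorname{colspace}(\widehat F^mN_m))$ maps the solution set bijectively onto $\Delta^m(X)$. This formulates $X$ using $k(n-k)(m-1)$ equations in an affine space of dimension $k(n-k)m-|\boldsymbol\alpha|$. In particular, if $\boldsymbol\alpha$ is a Schubert problem, then $X=X_{\alpha^1}F^1_\bullet\cap\cdots\cap X_{\alpha^m}F^m_\bullet$, and $X$ is formulated as the set of solutions to a square system of equations (the number of equations equals the number of variables).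
   Context: $V=\mathbb{C}^n$ is the space of row vectors, $V^*$ the dual space of column vectors, $0<k<n$. $\binom{[n]}{k}$ is the set of increasing $k$-tuples $\alpha=(\alpha_1<\dots<\alpha_k)$ from $[n]$ (Schubert conditions). For a complete flag $F_\bullet$ in $V$ ($\dim F_i=i$), $X_\alpha F_\bullet=\{H\in \mathrm{Gr}(k,V):\dim(H\cap F_{\alpha_i})\ge i,\ i\in[k]\}$, of codimension $|\alpha|=k(n-k)-\sum_i(\alpha_i-i)$. $|\boldsymbol\alpha|=\sum_i|\alpha^i|$; $\boldsymbol\alpha$ is a Schubert problem if $|\boldsymbol\alpha|=k(n-k)$. $\alpha^\perp\in\binom{[n]}{n-k}$ is the increasing rearrangement of $\{n+1-j:j\in[n]\setminus\alpha\}$. For $H\in \mathrm{Gr}(k,V)$, $H^\perp\in \mathrm{Gr}(n-k,V^* )$ is its annihilator, and $\Delta^m(H)=(H,H^\perp,\dots,H^\perp)\in \mathrm{Gr}(k,V)\times \mathrm{Gr}(n-k,V^* )^{m-1}$. Coordinates: $\mathrm S_\alpha$ is the affine space of $k\times n$ matrices with $M_{i,\alpha_j}=\delta_{ij}$ and $M_{i,j}=0$ for $j>\alpha_i$, other entries arbitrary. For $\beta\in\binom{[n]}{n-k}$, $\widehat{\mathrm S}_\beta$ is the affine space of $n\times(n-k)$ matrices with $N_{n+1-\beta_i,j}=\delta_{ij}$ and $N_{i,j}=0$ for $i<n+1-\beta_j$, other entries arbitrary. For a flag $F_\bullet$, $F$ denotes an invertible $n\times n$ matrix whose first $i$ rows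 span $F_i$ for all $i$, and $\widehat F$ denotes an invertible $n\times n$ matrix whose last $i$ columns span the annihilator $(F_{n-i})^\perp\subset V^*$ for all $i$. $X^\circ_\alpha F_\bullet=\{\operatorname{rowspace}(MF):M\in\mathrm S_\alpha\}$, a dense open subset of $X_\alpha F_\bullet$. *)

(* Defs.v *)
From HB Require Import structures.
From mathcomp Require Import all_boot all_order all_algebra.
From mathcomp Require Import boolp classical_sets functions reals.
From mathcomp Require Import complex mpoly.

Set Implicit Arguments.
Unset Strict Implicit.
Unset Printing Implicit Defensive.

Import GRing.Theory.
Local Open Scope classical_set_scope.
Local Open Scope ring_scope.

(* All indices are 0-based: [tnth a i] is the informal alpha_(i+1) - 1. *)
Record schubert_cond (n k : nat) := SchubertCond {
  sc_tuple :> k.-tuple 'I_n;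
  sc_sorted : sorted (fun i j : 'I_n => (i < j)%N) sc_tuple
}.

(* The 1-based alpha_i - i is the 0-based [tnth a i - i]; both subtractions
   below are exact because [a] is strictly increasing. *)
Definition codim (n k : nat) (a : schubert_cond n k) : nat :=
  (k * (n - k) - \sum_(i < k) (tnth a i - i))%N.

Lemma sc_uniq n k (a : schubert_cond n k) : uniq a.
Proof.
apply: (@sorted_uniq _ (fun i j : 'I_n => (i < j)%N)); last exact: sc_sorted.
- by move=> ? ? ?; apply: ltn_trans.
- by move=> ?; apply: ltnn.
Qed.

(* [rev_ord j] is the 0-based version of n + 1 - j. *)
Definition perp_seq (n k : nat) (a : schubert_cond n k) : seq 'I_n :=
  sort (fun i j : 'I_n => (i <= j)%N) [seq rev_ord j | j <- enum [predC sc_tuple a]].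

Lemma size_perp_seq n k (a : schubert_cond n k) :
  size (perp_seq a) == (n - k)%N.
Proof.
rewrite size_sort size_map -cardE.
have := cardC (mem (sc_tuple a)).
by rewrite card_ord (card_uniqP (sc_uniq a)) size_tuple => /(canRL (addKn _)) ->.
Qed.

Lemma perp_seq_sorted n k (a : schubert_cond n k) :
  sorted (fun i j : 'I_n => (i < j)%N) (perp_seq a).
Proof.
have -> : (fun i j : 'I_n => (i < j)%N) = relpre val ltn by [].
rewrite -sorted_map ltn_sorted_uniq_leq.
rewrite (map_inj_uniq val_inj) sort_uniq (map_inj_uniq rev_ord_inj) enum_uniq /=.
by rewrite sorted_map; apply: sort_sorted => i j; apply: leq_total.
Qed.

Definition sc_perp (n k : nat) (a : schubert_cond n k) :
    schubert_cond n (n - k) :=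
  @SchubertCond n (n - k) (Tuple (size_perp_seq a)) (perp_seq_sorted a).

Definition total_codim (n k m : nat) (a : 'I_m -> schubert_cond n k) : nat :=
  (\sum_(i < m) codim (a i))%N.

Definition schubert_problem (n k m : nat) (a : 'I_m -> schubert_cond n k) :=
  total_codim a = (k * (n - k))%N.

Definition CC (R : realType) : fieldType := R[i].

Section Geometry.
Variable K : fieldType.

Definition rowspace (k n : nat) (A : 'M[K]_(k, n)) : {vspace 'rV[K]_n} :=
  <<[seq row i A | i <- enum 'I_k]>>%VS.

Definition colspace (n l : nat) (A : 'M[K]_(n, l)) : {vspace 'cV[K]_n} :=
  <<[seq col j A | j <- enum 'I_l]>>%VS.

(* Common kernel of the pairings [fun c => h *m c], for [h] in a basis of [H];
   characterized by [annihP] below. *)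
Definition annih (n : nat) (H : {vspace 'rV[K]_n}) : {vspace 'cV[K]_n} :=
  (\bigcap_(h <- vbasis H) lker (linfun (mulmx h : 'cV[K]_n -> 'M[K]_1)))%VS.

Lemma annihP n (H : {vspace 'rV[K]_n}) (c : 'cV[K]_n) :
  reflect (forall h, h \in H -> h *m c = 0) (c \in annih H).
Proof.
have E : (c \in annih H) = all (fun h => h *m c == 0) (vbasis H).
  rewrite /annih; elim: (tval (vbasis H)) => [|h s IHs] /=.
    by rewrite big_nil memvf.
  by rewrite big_cons memv_cap memv_ker lfunE /= IHs.
rewrite E; apply: (iffP allP) => [Z h hH | Z h hb].
  rewrite (coord_vbasis hH) mulmx_suml big1 // => i _.
  by rewrite -scalemxAl (eqP (Z _ (mem_nth _ _))) ?scaler0 // size_tuple.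
by apply/eqP/Z/vbasis_mem.
Qed.

Record flag (n : nat) := Flag {
  flag_space :> 'I_n.+1 -> {vspace 'rV[K]_n};
  flag_dim : forall i, \dim (flag_space i) = i;
  flag_sub : forall i j : 'I_n.+1,
    (i <= j)%N -> (flag_space i <= flag_space j)%VS
}.

Definition flag_matrix (n : nat) (F : flag n) (A : 'M[K]_n) : Prop :=
  A \in unitmx /\
  forall i : 'I_n.+1, <<[seq row j A | j : 'I_n <- enum 'I_n & (j < i)%N]>>%VS = F i.

(* [rev_ord i : 'I_n.+1] has value n - i. *)
Definition dual_flag_matrix (n : nat) (F : flag n) (A : 'M[K]_n) : Prop :=
  A \in unitmx /\
  forall i : 'I_n.+1,
    <<[seq col j A | j : 'I_n <- enum 'I_n & (n - i <= j)%N]>>%VS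
      = annih (F (rev_ord i)).

Definition S_space (n k : nat) (a : schubert_cond n k) : set 'M[K]_(k, n) :=
  [set M | (forall i j : 'I_k, M i (tnth a j) = (i == j)%:R) /\
           (forall (i : 'I_k) (j : 'I_n), (tnth a i < j)%N -> M i j = 0)].

Definition Shat_space (n l : nat) (b : schubert_cond n l) : set 'M[K]_(n, l) :=
  [set N | (forall i j : 'I_l, N (rev_ord (tnth b i)) j = (i == j)%:R) /\
           (forall (i : 'I_n) (j : 'I_l),
              (i < rev_ord (tnth b j))%N -> N i j = 0)].

(* The 1-based F_(alpha_i) is the member of the flag of index [tnth a i + 1],
   that is, [lift ord0 (tnth a i)]. *)
Definition schubert_variety (n k : nat) (a : schubert_cond n k) (F : flag n) :
    set {vspace 'rV[K]_n} :=
  [set H | \dim H = k /\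
     forall i : 'I_k, (i < \dim (H :&: F (lift ord0 (tnth a i))))%N].

(* The set does not depend on the choice of the matrix of the flag. *)
Definition open_schubert (n k : nat) (a : schubert_cond n k) (F : flag n) :
    set {vspace 'rV[K]_n} :=
  [set H | exists A M, [/\ flag_matrix F A, S_space a M
                         & H = rowspace (M *m A)]].

Section General.
Variables n m : nat.

Definition entries (A : 'I_m -> 'M[K]_n) :
    'I_#|{: 'I_m * 'I_n * 'I_n}| -> K :=
  fun v => let: (i, r, c) := enum_val v in A i r c.

(* Zariski topology on the m-fold product of the flag variety GL_n / B: a set
   of m-tuples of flags is open when its preimage in GL_n ^ m is the locus
   where some family of polynomials in the matrix entries does not vanish
   identically. *)
Definition zariski_open (U : set ('I_m -> flag n)) : Prop :=
  exists S : set {mpoly K[#|{: 'I_m * 'I_n * 'I_n}|]},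
    forall (F : 'I_m -> flag n) (A : 'I_m -> 'M[K]_n),
      (forall i, flag_matrix (F i) (A i)) ->
      (U F <-> exists2 p, S p & p.@[entries A] != 0).

Definition for_general_flags (P : ('I_m -> flag n) -> Prop) : Prop :=
  exists U : set ('I_m -> flag n),
    [/\ zariski_open U, U !=set0 & forall F, U F -> P F].

End General.

Definition affine_space_of_dim (V : vectType K) (S : set V) (d : nat) : Prop :=
  exists (x0 : V) (W : {vspace V}),
    \dim W = d /\ S = [set x | x - x0 \in W].

(* A list of m + 1 conditions (so the informal m is [m.+1]) is indexed by
   ['I_m.+1]; index [ord0] is the first condition and [lift ord0 i], for
   [i : 'I_m], the remaining ones. *)
Section System.
Variables n k m : nat.

(* (M, (N_2, ..., N_(m+1))) *)
Definition unknowns : Type :=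
  ('M[K]_(k, n) * {ffun 'I_m -> 'M[K]_(n, n - k)})%type.

Definition coordinates (a : 'I_m.+1 -> schubert_cond n k) : set unknowns :=
  [set x : unknowns | S_space (a ord0) x.1 /\
           forall i : 'I_m, Shat_space (sc_perp (a (lift ord0 i))) (x.2 i)].

Definition solutions (a : 'I_m.+1 -> schubert_cond n k)
    (F1 : 'M[K]_n) (Fhat : 'I_m -> 'M[K]_n) : set unknowns :=
  [set x : unknowns | coordinates a x /\
           forall i : 'I_m, x.1 *m F1 *m Fhat i *m x.2 i = 0].

(* The scalar equations making up the system: entry (r, c) of the i-th matrix
   equation. *)
Definition eqn_index : finType := ('I_m * 'I_k * 'I_(n - k))%type.

Definition bilin_eqn (F1 : 'M[K]_n) (Fhat : 'I_m -> 'M[K]_n) (e : eqn_index)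
    (M : 'M[K]_(k, n)) (N : 'M[K]_(n, n - k)) : K :=
  (M *m F1 *m Fhat e.1.1 *m N) e.1.2 e.2.

Definition subspaces_of (F1 : 'M[K]_n) (Fhat : 'I_m -> 'M[K]_n)
    (x : unknowns) : {vspace 'rV[K]_n} * {ffun 'I_m -> {vspace 'cV[K]_n}} :=
  (rowspace (x.1 *m F1), [ffun i => colspace (Fhat i *m x.2 i)]).

Definition dual_diagonal (H : {vspace 'rV[K]_n}) :
    {vspace 'rV[K]_n} * {ffun 'I_m -> {vspace 'cV[K]_n}} :=
  (H, [ffun => annih H]).

End System.
End Geometry.

(* Main.v *)
(** Let P and Q be the 0/1 matrices selecting the coordinates in alpha and
    outside alpha.  Then S_alpha consists of the P + X Q and
    Shat_(alpha^perp) of the Q^T - P^T X, where X runs over the same space of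
    k x (n - k) matrices, and (P + X Q) (Q^T - P^T Y) = X - Y.  Since Fhat^-1 is
    a matrix of the flag, rowspace ((P + X Q) Fhat^-1) has annihilator
    colspace (Fhat (Q^T - P^T X)); this gives the bijection, for all flags.

    For a Schubert problem, a point of the closed but not of the open
    intersection lies in open cells whose codimensions add up to more than
    k (n - k).  Tuples of matrices A^i of flags for which such cells share a
    point rowspace h are polynomial images of a space of too small a dimension:
    (P_i + X_i Q_i) A^i = g_i h expresses A^i by g_i, h, X_i and Q_i A^i.
    Counting monomials yields a nonzero polynomial vanishing on each of these
    finitely many images, and flags outside the zero locus are general. *)

Require Import Defs.
From HB Require Import structures.
From mathcomp Require Import all_boot all_order all_algebra.
From mathcomp Require Import boolp classical_sets functions reals.
From mathcomp Require Import perm complex mpoly.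

Set Implicit Arguments.
Unset Strict Implicit.
Unset Printing Implicit Defensive.

Import GRing.Theory.
Local Open Scope classical_set_scope.
Local Open Scope ring_scope.

(** * Polynomials *)

Lemma base_expansion_inj (B d : nat) (u v : 'I_d -> nat) :
    (forall i, u i < B)%N -> (forall i, v i < B)%N ->
  (\sum_(i < d) u i * B ^ i = \sum_(i < d) v i * B ^ i)%N -> u =1 v.
Proof.
elim: d u v => [|d IH] u v uB vB; first by move=> _ [].
have split_sum (w : 'I_d.+1 -> nat) : (\sum_(i < d.+1) w i * B ^ i =
    (\sum_(i < d) w (lift ord0 i) * B ^ i) * B + w ord0)%N.
  rewrite big_ord_recl expn0 muln1 addnC big_distrl /=; congr (_ + _)%N.
  by apply: eq_bigr => i _; rewrite /= /bump /= add1n expnSr mulnA.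
rewrite !split_sum => eq_uv.
have eq_head : u ord0 = v ord0.
  by have /(congr1 (modn^~ B)) := eq_uv; rewrite !modnMDl !modn_small.
have B_gt0 : (0 < B)%N by apply: leq_ltn_trans (uB ord0).
move: eq_uv; rewrite eq_head => /addIn/eqP; rewrite eqn_pmul2r // => /eqP eq_tail.
move=> i; case: (unliftP ord0 i) => [j ->|-> //].
by apply: (IH (fun j => u (lift ord0 j)) (fun j => v (lift ord0 j))).
Qed.

Section NonvanishingPoints.
Variable R : idomainType.

Lemma poly_nonroot (e : nat -> R) (p : {poly R}) :
  injective e -> p != 0 -> exists i, ~~ root p (e i).
Proof.
move=> e_inj p_neq0; pose s := [seq e i | i <- iota 0 (size p)].
have /allPn[_ /mapP[i _ ->]] : ~~ all (root p) s; last by exists i.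
have s_uniq : uniq s by rewrite map_inj_uniq ?iota_uniq.
apply/negP => /(max_poly_roots p_neq0)/(_ s_uniq).
by rewrite size_map size_iota ltnn.
Qed.

Variable d : nat.
Implicit Types (m : 'X_{1..d}) (p : {mpoly R[d]}).

Definition kronecker_weight (B : nat) m := (\sum_(i < d) m i * B ^ i)%N.

Definition kronecker_subst (B : nat) p : {poly R} :=
  \sum_(m <- msupp p) p@_m *: 'X^(kronecker_weight B m).

Lemma horner_kronecker_subst B p t :
  (kronecker_subst B p).[t] = p.@[fun i => t ^+ (B ^ i)].
Proof.
rewrite mevalE horner_sum; apply: eq_bigr => m _.
rewrite hornerZ hornerXn expr_sum; congr (_ * _).
by apply: eq_bigr => i _; rewrite mulnC exprM.
Qed.

Lemma leq_mnm_mdeg m i : (m i <= mdeg m)%N.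
Proof. by rewrite mdegE (bigD1 i) //= leq_addr. Qed.

Lemma kronecker_weight_inj B m m' : (mdeg m < B)%N -> (mdeg m' < B)%N ->
  kronecker_weight B m = kronecker_weight B m' -> m = m'.
Proof.
move=> mB m'B /base_expansion_inj eq_m; apply/mnmP => i.
by apply: eq_m => j; apply: leq_ltn_trans (leq_mnm_mdeg _ _) _.
Qed.

Lemma kronecker_subst_neq0 p : p != 0 -> kronecker_subst (msize p) p != 0.
Proof.
move=> p_neq0; pose B := msize p; apply: contra_neq (p_neq0) => q0.
have lead_supp : mlead p \in msupp p by rewrite mlead_supp.
have : (kronecker_subst B p)`_(kronecker_weight B (mlead p)) = 0.
  by rewrite q0 coef0.
rewrite coef_sum (bigD1_seq (mlead p)) //= big_seq_cond big1.
  by rewrite addr0 coefZ coefXn eqxx mulr1 => /eqP; rewrite mleadc_eq0 => /eqP.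
move=> m /andP[m_supp m_neq]; rewrite coefZ coefXn.
case: eqP => [/kronecker_weight_inj eq_m|_]; last by rewrite mulr0.
by rewrite eq_m ?msize_mdeg_lt ?eqxx in m_neq.
Qed.

Lemma mpoly_nonvanishing (e : nat -> R) p :
  injective e -> p != 0 -> exists v : 'I_d -> R, p.@[v] != 0.
Proof.
move=> e_inj /kronecker_subst_neq0/(poly_nonroot e_inj)[t].
by rewrite /root horner_kronecker_subst; exists (fun i => e t ^+ (msize p ^ i)).
Qed.

End NonvanishingPoints.

Section AlgebraicDependence.
Variable K : fieldType.

Lemma msizeM_leq d (p q : {mpoly K[d]}) (x y : nat) :
  (msize p <= x.+1)%N -> (msize q <= y.+1)%N -> (msize (p * q) <= (x + y).+1)%N.
Proof.
have [->|p_neq0] := eqVneq p 0; first by rewrite mul0r msize0.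
have [->|q_neq0] := eqVneq q 0; first by rewrite mulr0 msize0.
by move=> px qy; rewrite msizeM // -subn1 leq_subLR add1n -addnS -addSn leq_add.
Qed.

Lemma msize_prod_exp_leq d N (f : 'I_N -> {mpoly K[d]}) (u : 'I_N -> nat)
    (x : nat) :
  (forall j, msize (f j) <= x.+1)%N ->
  (msize (\prod_j f j ^+ u j) <= ((\sum_j u j) * x).+1)%N.
Proof.
move=> f_le; rewrite big_distrl /=.
elim/big_rec2: _ => [|j y p _ le_py]; first by rewrite msize1.
apply: msizeM_leq le_py; elim: (u j) => [|r IHr]; first by rewrite msize1.
by rewrite exprS mulSn; apply: msizeM_leq.
Qed.

(* Polynomials of degree at most B involve only the (B + 1)^d monomials all of
   whose exponents are at most B. *)
Lemma mpoly_linear_dependence d (I : finType) (F : I -> {mpoly K[d]})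
    (B : nat) :
    (forall u, msize (F u) <= B.+1)%N -> (B.+1 ^ d < #|I|)%N ->
  exists2 z : I -> K, exists u, z u != 0 & \sum_u z u *: F u = 0.
Proof.
move=> F_le lt_card; pose mon := {ffun 'I_d -> 'I_B.+1}.
pose C : 'M[K]_(#|I|, #|mon|) := \matrix_(u, w)
  (F (enum_val u))@_[multinom ((enum_val w : mon) i : nat) | i < d].
have /rowV0Pn[z /sub_kermxP zC z_neq0] : kermx C != 0.
  rewrite kermx_eq0 /row_free eqn_leq negb_and -!ltnNge.
  by rewrite (leq_ltn_trans (rank_leq_col C)) ?orbT // card_ffun !card_ord.
exists (fun u => z 0 (enum_rank u)).
  by have /rV0Pn[u zu] := z_neq0; exists (enum_val u); rewrite enum_valK.
apply/mpolyP => m; rewrite mcoeff0 linear_sum /=.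
have [lt_mB|le_Bm] := ltnP (mdeg m) B.+1; last first.
  apply: big1 => u _; rewrite mcoeffZ memN_msupp_eq0 ?mulr0 // msize_mdeg_ge //.
  exact: leq_trans (F_le u) le_Bm.
have lt_m i : (m i < B.+1)%N by apply: leq_ltn_trans (leq_mnm_mdeg _ _) lt_mB.
have /rowP/(_ (enum_rank [ffun i => Ordinal (lt_m i)])) := zC.
rewrite [LHS]mxE [RHS]mxE => zCm; rewrite -[RHS]zCm.
rewrite (reindex _ (onW_bij _ (enum_val_bij I))).
apply: eq_bigr => u _; rewrite mcoeffZ enum_valK mxE; congr (_ * _@__).
by apply/mnmP => i; rewrite mnmE enum_rankK ffunE.
Qed.

(* There are D^N monomials with exponents less than D in N variables, and
   substituting [f] in them involves only O(D^d) monomials. *)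
Lemma algebraic_dependence d N (f : N.-tuple {mpoly K[d]}) : (d < N)%N ->
  exists2 p : {mpoly K[N]}, p != 0 & p \mPo f = 0.
Proof.
move=> lt_dN; pose e := (\max_(j < N) msize (tnth f j))%N.
pose c := (N * e).+1; pose D := (c ^ d).+1.
pose exponents := {ffun 'I_N -> 'I_D}.
pose F (u : exponents) := \prod_j tnth f j ^+ u j.
have F_le u : (msize (F u) <= (N * D * e).+1)%N.
  have f_le j : (msize (tnth f j) <= e.+1)%N.
    by apply: leqW; apply: (leq_bigmax j).
  apply: leq_trans (msize_prod_exp_leq _ f_le) _; rewrite ltnS leq_mul2r.
  rewrite -[N in (_ <= N * _)%N]card_ord -sum_nat_const leq_sum ?orbT // => j _.
  exact: ltnW.
have card_gt : ((N * D * e).+1 ^ d < #|exponents|)%N.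
  have le_cD : ((N * D * e).+1 <= c * D)%N.
    by rewrite mulSn -mulnAC addSn ltnS leq_addl.
  rewrite card_ffun !card_ord; apply: leq_trans (leq_pexp2l _ lt_dN) => //.
  apply: (@leq_ltn_trans ((c * D) ^ d)).
    by case: (posnP d) => [->//|d_gt0]; rewrite leq_exp2r.
  by rewrite expnMn expnS ltn_pmul2r ?expn_gt0.
have [z [u0 zu0] zF] := mpoly_linear_dependence F_le card_gt.
pose mon (u : exponents) : 'X_{1..N} := [multinom (u j : nat) | j < N].
have mon_inj : injective mon.
  move=> u u' /mnmP eq_uu'; apply/ffunP => j; apply: val_inj.
  by have := eq_uu' j; rewrite !mnmE.
exists (\sum_u z u *: 'X_[mon u]).
  apply: contra_neq zu0 => /(congr1 (mcoeff (mon u0))).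
  rewrite mcoeff0 linear_sum (bigD1 u0) //= mcoeffZ mcoeffX eqxx mulr1.
  rewrite big1 ?addr0 // => u neq_u.
  by rewrite mcoeffZ mcoeffX (inj_eq mon_inj) (negPf neq_u) mulr0.
rewrite -[RHS]zF linear_sum; apply: eq_bigr => u _ /=.
by rewrite comp_mpolyZ comp_mpolyX; under eq_bigr do rewrite mnmE.
Qed.

End AlgebraicDependence.

Local Notation entries_poly K m n := {mpoly K[#|{: 'I_m * 'I_n * 'I_n}|]}.

Section PolynomialMaps.
Variables (K : fieldType) (V : vectType K).

Definition vcoord (v : V) (i : 'I_(\dim {:V})) : K := coord (vbasis {:V}) i v.

Definition polynomial_mx p q (A : V -> 'M[K]_(p, q)) : Prop :=
  exists P : 'M[{mpoly K[\dim {:V}]}]_(p, q),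
    forall v, A v = map_mx (meval (vcoord v)) P.

Lemma polynomial_mx_cst p q (C : 'M[K]_(p, q)) : polynomial_mx (fun=> C).
Proof.
exists (map_mx (@mpolyC _ K) C) => v.
by apply/matrixP => i j; rewrite !mxE; apply/esym/mevalC.
Qed.

Lemma polynomial_mx_linear p q (A : V -> 'M[K]_(p, q)) :
  linear A -> polynomial_mx A.
Proof.
move=> A_lin; pose f : {linear V -> 'M[K]_(p, q)} :=
  HB.pack A (GRing.isLinear.Build _ _ _ _ _ A_lin).
exists (\matrix_(i, j) \sum_(l < \dim {:V}) A (vbasis {:V})`_l i j *: 'X_l).
move=> v; apply/matrixP => i j.
rewrite !mxE -[A v]/(f v) {1}(coord_vbasis (memvf v)).
rewrite !linear_sum summxE; apply: eq_bigr => l _.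
by rewrite linearZ mxE /= mevalZ mevalXU mulrC.
Qed.

Lemma polynomial_mxD p q (A B : V -> 'M[K]_(p, q)) :
  polynomial_mx A -> polynomial_mx B -> polynomial_mx (fun v => A v + B v).
Proof. by case=> P AE [Q BE]; exists (P + Q) => v; rewrite map_mxD AE BE. Qed.

Lemma polynomial_mxB p q (A B : V -> 'M[K]_(p, q)) :
  polynomial_mx A -> polynomial_mx B -> polynomial_mx (fun v => A v - B v).
Proof. by case=> P AE [Q BE]; exists (P - Q) => v; rewrite map_mxB AE BE. Qed.

Lemma polynomial_mxM p q r (A : V -> 'M[K]_(p, q)) (B : V -> 'M[K]_(q, r)) :
  polynomial_mx A -> polynomial_mx B -> polynomial_mx (fun v => A v *m B v).
Proof. by case=> P AE [Q BE]; exists (P *m Q) => v; rewrite map_mxM AE BE. Qed.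

Lemma polynomial_image_in_hypersurface n m (A : V -> 'I_m -> 'M[K]_n) :
    (forall i, polynomial_mx (A ^~ i)) -> (\dim {:V} < m * n * n)%N ->
  exists2 p : entries_poly K m n, p != 0 &
    forall v, p.@[entries (A v)] = 0.
Proof.
move=> /choice[P AE] dim_lt.
pose f := [tuple let: (i, r, c) := enum_val x in P i r c
          | x < #|{: 'I_m * 'I_n * 'I_n}|].
have [|p p_neq0 pf] := algebraic_dependence f.
  by rewrite !card_prod !card_ord.
exists p => // v; rewrite -[RHS](meval0 (vcoord v)) -pf comp_mpoly_meval.
apply: meval_eq => x; rewrite tnth_mktuple /entries.
by case: (enum_val x) => [[i r] c]; rewrite AE mxE.
Qed.

End PolynomialMaps.

(** * Schubert conditions *)

HB.instance Definition _ n k := [isSub for @sc_tuple n k].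
HB.instance Definition _ n k := [Finite of schubert_cond n k by <:].

Lemma tnth_sc_inj n k (b : schubert_cond n k) : injective (tnth b).
Proof. by apply/tuple_uniqP; apply: sc_uniq. Qed.

Lemma card_sum_pred (T : finType) (P : pred T) : #|P| = (\sum_x P x)%N.
Proof.
rewrite -sum1_card big_mkcond; apply: eq_bigr => x _.
by rewrite -topredE /=; case: (P x).
Qed.

Lemma card_ord_ltn (n d : nat) :
  (d <= n)%N -> #|[pred i : 'I_n | (i < d)%N]| = d.
Proof.
by move=> le_dn; rewrite -sum1_card (big_ord_narrow le_dn) sum1_card card_ord.
Qed.

Section SchubertConditions.
Variables n k : nat.
Implicit Types b : schubert_cond n k.

Lemma leq_sc_size b : (k <= n)%N.
Proof.
rewrite -[k]card_ord -[n in (_ <= n)%N]card_ord.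
exact/leq_card/tnth_sc_inj.
Qed.

Lemma ltn_tnth_sc b (i j : 'I_k) : (tnth b i < tnth b j)%N = (i < j)%N.
Proof.
have homo (x y : 'I_k) : (x < y)%N -> (tnth b x < tnth b y)%N.
  have z := tnth b x; move=> lt_xy; rewrite !(tnth_nth z).
  apply: (sorted_ltn_nth _ _ (sc_sorted b)); rewrite ?inE ?size_tuple //.
  by move=> u v w; apply: ltn_trans.
case: (ltngtP i j) => [/homo-> //|/homo|/val_inj->]; last exact: ltnn.
by move/ltnW; rewrite ltnNge => ->.
Qed.

Lemma sc_of_injective (f : 'I_k -> 'I_n) : injective f ->
  exists b (s : 'S_k), forall i, tnth b i = f (s i).
Proof.
move=> f_inj; pose le := (fun i j : 'I_n => (i <= j)%N).
pose t := [tuple f i | i < k]; pose st := [tuple of sort le t].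
have st_sorted : sorted (fun i j : 'I_n => (i < j)%N) st.
  have -> : (fun i j : 'I_n => (i < j)%N) = relpre val ltn by [].
  rewrite -sorted_map ltn_sorted_uniq_leq (map_inj_uniq val_inj) sort_uniq.
  rewrite (map_inj_uniq f_inj) enum_uniq sorted_map /=.
  by apply: sort_sorted => i j; apply: leq_total.
have /tuple_permP[s stE] : perm_eq st t by rewrite perm_sort.
exists (SchubertCond st_sorted), s => i.
by have /val_inj stE' := stE; rewrite /= stE' !tnth_mktuple.
Qed.

(* Lists the complement of [b] in decreasing order. *)
Definition perp_elt b (j : 'I_(n - k)) : 'I_n := rev_ord (tnth (sc_perp b) j).

Lemma perp_elt_inj b : injective (perp_elt b).
Proof. by move=> i j /rev_ord_inj; apply: tnth_sc_inj. Qed.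

Lemma perm_perp_elt b :
  perm_eq [seq perp_elt b j | j <- enum 'I_(n - k)] (enum [predC tval b]).
Proof.
rewrite (map_comp (@rev_ord n)) map_tnth_enum.
have /(perm_map (@rev_ord n)) /perm_trans -> // : perm_eq (perp_seq b)
    [seq rev_ord j | j <- enum [predC sc_tuple b]] by rewrite perm_sort.
by rewrite -map_comp map_id_in // => c _; apply: rev_ordK.
Qed.

Lemma big_sc_perp (S : Type) (idx : S) (op : Monoid.com_law idx) b
    (F : 'I_n -> S) :
  \big[op/idx]_c F c =
  op (\big[op/idx]_i F (tnth b i)) (\big[op/idx]_j F (perp_elt b j)).
Proof.
rewrite (bigID (mem (tval b))) -big_uniq ?sc_uniq //= big_tuple; congr (op _ _).
rewrite (eq_bigl [predC tval b]) // -[LHS]big_enum.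
by rewrite -(perm_big _ (perm_perp_elt b)) big_map big_enum.
Qed.

Lemma tnth_or_perp_elt b c :
  (exists i, c = tnth b i) \/ (exists j, c = perp_elt b j).
Proof.
have [/tnthP[i ->]|c_notin] := boolP (c \in tval b); first by left; exists i.
right; have : c \in enum [predC tval b] by rewrite mem_enum.
by rewrite -(perm_mem (perm_perp_elt b)) => /mapP[j _ ->]; exists j.
Qed.

Lemma perp_elt_neq b i j : (perp_elt b j == tnth b i) = false.
Proof.
have : perp_elt b j \in enum [predC tval b].
  by rewrite -(perm_mem (perm_perp_elt b)) map_f ?mem_enum.
by rewrite mem_enum; apply: contraNF => /eqP->; apply: mem_tnth.
Qed.

Definition descent b (p : 'I_k * 'I_(n - k)) : bool :=
  (perp_elt b p.2 < tnth b p.1)%N.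

Lemma descentNE b i j : ~~ descent b (i, j) = (tnth b i < perp_elt b j)%N.
Proof. by rewrite -leqNgt leq_eqVlt val_eqE eq_sym perp_elt_neq. Qed.

Lemma ltn_card_sc b (i : 'I_k) (d : nat) :
  (i < #|[pred j | (tnth b j < d)%N]|)%N = (tnth b i < d)%N.
Proof.
have [lt_id|le_di] := ltnP (tnth b i) d.
  rewrite -{1}(card_ord_ltn (ltn_ord i)).
  apply/subset_leq_card/fintype.subsetP => j; rewrite !inE ltnS => le_ji.
  by apply: leq_ltn_trans lt_id; rewrite leqNgt ltn_tnth_sc -leqNgt.
apply/negbTE; rewrite -leqNgt -[leqRHS](card_ord_ltn (ltnW (ltn_ord i))).
apply/subset_leq_card/fintype.subsetP => j; rewrite !inE => lt_jd.
by rewrite -(ltn_tnth_sc b) (leq_trans lt_jd).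
Qed.

Lemma tnth_scE b i : tnth b i = (i + #|[pred j | descent b (i, j)]|)%N :> nat.
Proof.
rewrite -[LHS](card_ord_ltn (ltnW (ltn_ord _))) card_sum_pred.
rewrite (big_sc_perp addn b) /=.
rewrite -[X in _ = (X + _)%N](card_ord_ltn (ltnW (ltn_ord i))) !card_sum_pred.
by congr (_ + _)%N; apply: eq_bigr => j _; rewrite /= ltn_tnth_sc.
Qed.

Lemma card_descent b : #|descent b| = (\sum_(i < k) (tnth b i - i))%N.
Proof.
rewrite card_sum_pred.
rewrite -(pair_bigA _ (fun i j => nat_of_bool (descent b (i, j)))) /=.
by apply: eq_bigr => i _; rewrite tnth_scE addKn card_sum_pred.
Qed.

Lemma leq_card_descent b : (#|descent b| <= k * (n - k))%N.
Proof. by apply: leq_trans (max_card _) _; rewrite card_prod !card_ord. Qed.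

Lemma card_descentE b : #|descent b| = (k * (n - k) - codim b)%N.
Proof. by rewrite /codim -card_descent subKn ?leq_card_descent. Qed.

Lemma leq_codim b : (codim b <= k * (n - k))%N.
Proof. exact: leq_subr. Qed.

Lemma card_descent_leqif b b' : (forall i, tnth b i <= tnth b' i)%N ->
  (#|descent b| <= #|descent b'| ?= iff (b == b'))%N.
Proof.
move=> le_bb'; rewrite !card_descent.
have -> : (b == b') = [forall (i | true), (tnth b i - i == tnth b' i - i)%N].
  apply/eqP/forallP => [-> i /=|eq_bb']; first exact: eqxx.
  apply/val_inj/eq_from_tnth => i; apply/val_inj/eqP.
  have := eq_bb' i; rewrite /= eqn_sub2rE //.
  - by rewrite tnth_scE leq_addr.
  - by rewrite tnth_scE leq_addr.
by apply: leqif_sum => i _; apply/leqif_eq/leq_sub2r.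
Qed.

Lemma codim_leqif b b' : (forall i, tnth b i <= tnth b' i)%N ->
  (codim b' <= codim b ?= iff (b == b'))%N.
Proof.
move/card_descent_leqif; rewrite /codim -!card_descent => -[le_desc <-].
split; first exact: leq_sub2l le_desc.
by rewrite eqn_sub2lE ?leq_card_descent // eq_sym.
Qed.

End SchubertConditions.

Lemma total_codim_leqif n k m (a b : 'I_m -> schubert_cond n k) :
    (forall i j, tnth (b i) j <= tnth (a i) j)%N ->
  (total_codim a <= total_codim b ?= iff [forall i, b i == a i])%N.
Proof. by move=> le_ba; apply: leqif_sum => i _; apply/codim_leqif/le_ba. Qed.

(** * Linear algebra *)

Section LinearAlgebra.
Variable K : fieldType.

Lemma affine_space_range (V W : vectType K) (g : W -> V) :
    linear (fun y => g y - g 0) -> injective g ->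
  affine_space_of_dim (range g) (\dim {:W}).
Proof.
move=> g_lin g_inj; pose f : {linear W -> V} :=
  HB.pack (fun y => g y - g 0) (GRing.isLinear.Build _ _ _ _ _ g_lin).
exists (g 0), (limg (linfun f)); split.
  apply: limg_dim_eq; apply/eqP; rewrite -subv0; apply/subvP => y.
  rewrite capfv memv_ker lfunE memv0 subr_eq0 => /eqP gy0.
  exact/eqP/g_inj.
apply/seteqP; split=> [_ [y _ <-]|x /memv_imgP[y _]].
  by rewrite /= -[_ - _]/(f y) -lfunE memv_img ?memvf.
by rewrite lfunE => /addIr ->; exists y.
Qed.

Lemma mem_span_familyP (V : vectType K) (I : finType) (P : pred I)
    (g : I -> V) v :
  reflect (exists x : I -> K, v = \sum_(j | P j) x j *: g j)
          (v \in <<[seq g j | j <- enum I & P j]>>%VS).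
Proof.
rewrite span_def big_map big_filter big_enum_cond.
apply: (iffP memv_sumP) => [[w w_line ->]|[x ->]].
  have /choice[x w_x] j : exists c, P j -> w j = c *: g j.
    have [/w_line/vlineP[c ->]|_] := boolP (P j); first by exists c.
    by exists 0.
  by exists x; apply: eq_bigr.
by exists (fun j => x j *: g j) => // j _; rewrite memvZ ?memv_line.
Qed.

Lemma free_filter_map (V : vectType K) (I : eqType) (g : I -> V) (s : seq I) P :
  free [seq g j | j <- s] -> free [seq g j | j <- s & P j].
Proof.
rewrite -(perm_free (perm_map g (permEl (perm_filterC P s)))) map_cat.
exact: catl_free.
Qed.

Section Rows.
Variables (k n : nat) (A : 'M[K]_(k, n)).

Lemma mem_span_rowsP (P : pred 'I_k) (v : 'rV[K]_n) :
  reflect (exists2 x : 'rV_k, (forall j, ~~ P j -> x 0 j = 0) & v = x *m A)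
          (v \in <<[seq row j A | j <- enum 'I_k & P j]>>%VS).
Proof.
apply: (iffP (mem_span_familyP _ _ _)) => [[x ->]|[x x0 ->]].
  exists (\row_j if P j then x j else 0) => [j /negPf Pj|].
    by rewrite mxE Pj.
  rewrite mulmx_sum_row big_mkcond; apply: eq_bigr => j _.
  by rewrite mxE; case: ifP; rewrite ?scale0r.
exists (x 0); rewrite mulmx_sum_row [RHS]big_mkcond; apply: eq_bigr => j _.
by case: ifP => // /negbT /x0 ->; rewrite scale0r.
Qed.

Lemma free_rows : row_free A -> free [seq row j A | j <- enum 'I_k].
Proof.
move=> A_free; apply/(@freeP _ _ _ [tuple row j A | j < k]) => x x0 j.
suff /rowP/(_ j) : \row_i x i = 0 by rewrite !mxE.
apply: (row_free_inj A_free); rewrite mul0mx -[RHS]x0 mulmx_sum_row.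
by apply: eq_bigr => i _; rewrite mxE -tnth_nth tnth_mktuple.
Qed.

Lemma dim_span_rows (P : pred 'I_k) : row_free A ->
  \dim <<[seq row j A | j <- enum 'I_k & P j]>>%VS = #|P|.
Proof.
by move/free_rows/(free_filter_map P)/eqnP => ->; rewrite size_map enumT cardE.
Qed.

Lemma rowspace_predT :
  rowspace A = <<[seq row j A | j <- enum 'I_k & predT j]>>%VS.
Proof. by rewrite filter_predT. Qed.

Lemma mem_rowspace (v : 'rV[K]_n) : (v \in rowspace A) = (v <= A)%MS.
Proof.
rewrite rowspace_predT.
by apply/mem_span_rowsP/submxP => [[x _ ->]|[x ->]]; exists x.
Qed.

Lemma mem_colspace (v : 'cV[K]_k) : (v \in colspace A) = (v^T <= A^T)%MS.
Proof.
rewrite /colspace -[enum _]filter_predT.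
apply/mem_span_familyP/submxP => [[x ->]|[x vE]].
  exists (\row_j x j); rewrite mulmx_sum_row linear_sum.
  by apply: eq_bigr => j _; rewrite mxE -tr_col linearZ.
exists (x 0); rewrite -[LHS]trmxK vE mulmx_sum_row linear_sum.
by apply: eq_bigr => j _; rewrite linearZ /= -tr_col trmxK.
Qed.

End Rows.

Lemma rowspace_eq k k' n (A : 'M[K]_(k, n)) (B : 'M[K]_(k', n)) :
  rowspace A = rowspace B <-> (A :=: B)%MS.
Proof.
split=> [eqAB|eqAB]; last by apply/vspaceP => v; rewrite !mem_rowspace eqAB.
by apply/eqmxP/andP; split; apply/rV_subP => v; rewrite -!mem_rowspace eqAB.
Qed.

Lemma colspace_eq n l l' (A : 'M[K]_(n, l)) (B : 'M[K]_(n, l')) :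
  colspace A = colspace B <-> (A^T :=: B^T)%MS.
Proof.
rewrite -rowspace_eq; split=> eqAB; apply/vspaceP => v.
  by rewrite !mem_rowspace -[v]trmxK -!mem_colspace eqAB.
by rewrite !mem_colspace -!mem_rowspace eqAB.
Qed.

Lemma dim_rowspace k n (A : 'M[K]_(k, n)) : \dim (rowspace A) = \rank A.
Proof.
have /rowspace_eq -> : (A :=: row_base A)%MS by apply/eqmx_sym/eq_row_base.
by rewrite rowspace_predT dim_span_rows ?row_base_free // card_ord.
Qed.

Lemma vspace_rowspace k n (H : {vspace 'rV[K]_n}) : \dim H = k ->
  exists2 h : 'M[K]_(k, n), row_free h & H = rowspace h.
Proof.
move=> <-; pose h : 'M[K]_(\dim H, n) := \matrix_i tnth (vbasis H) i.
have HE : H = rowspace h.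
  rewrite -{1}(span_basis (vbasisP H)) /rowspace; congr <<_>>%VS.
  by rewrite -[LHS]map_tnth_enum; apply: eq_map => i; rewrite rowK.
by exists h; rewrite // /row_free -dim_rowspace -HE.
Qed.

Lemma mem_annih_rowspace k n (A : 'M[K]_(k, n)) (c : 'cV[K]_n) :
  (c \in annih (rowspace A)) = (A *m c == 0).
Proof.
apply/annihP/eqP => [Ac0|Ac0 h].
  by apply/row_matrixP => i; rewrite row0 row_mul Ac0 // mem_rowspace row_sub.
by rewrite mem_rowspace => /submxP[x ->]; rewrite -mulmxA Ac0 mulmx0.
Qed.

Lemma mem_vspace_annih n (H : {vspace 'rV[K]_n}) (v : 'rV[K]_n) :
  v \in H <-> (forall c, c \in annih H -> v *m c = 0).
Proof.
split=> [vH c /annihP-> //|v0].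
have [k /vspace_rowspace[h _ HE]] : exists k, \dim H = k by exists (\dim H).
rewrite HE in v0 *; rewrite mem_rowspace submxE; apply/eqP/rowP => j.
have /v0/rowP/(_ 0) : col j (cokermx h) \in annih (rowspace h).
  by rewrite mem_annih_rowspace colE mulmxA mulmx_coker mul0mx.
by rewrite colE mulmxA -colE !mxE.
Qed.

Lemma annih_inj n : injective (@annih K n).
Proof.
move=> H H' eqHH'; apply/vspaceP => v.
apply/idP/idP => /mem_vspace_annih v0; apply/mem_vspace_annih.
  by rewrite -eqHH'.
by rewrite eqHH'.
Qed.

Lemma annih_colspaceP k n l (A : 'M[K]_(k, n)) (B : 'M[K]_(n, l)) :
    (\rank A + \rank B = n)%N ->
  annih (rowspace A) = colspace B <-> A *m B = 0.
Proof.
move=> rankAB; split=> [annA|AB0].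
  apply/matrixP => i j; have /eqP/matrixP/(_ i 0) : A *m col j B == 0.
    by rewrite -mem_annih_rowspace annA mem_colspace tr_col row_sub.
  by rewrite colE mulmxA -colE !mxE.
have BE : (B^T :=: kermx A^T)%MS.
  apply/eqmxP; have /mxrank_leqif_eq <- : (B^T <= kermx A^T)%MS.
    by apply/sub_kermxP; rewrite -trmx_mul AB0 trmx0.
  by rewrite mxrank_ker !mxrank_tr -[n in (n - _)%N]rankAB addKn.
apply/vspaceP => c; rewrite mem_annih_rowspace mem_colspace BE.
apply/eqP/sub_kermxP => [Ac0|]; first by rewrite -trmx_mul Ac0 trmx0.
by rewrite -trmx_mul => /(canRL trmxK); rewrite trmx0.
Qed.

End LinearAlgebra.

(** * Coordinates of Schubert cells *)

Section Charts.
Variables (K : fieldType) (n k : nat).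
Implicit Types (b : schubert_cond n k) (X Y : 'M[K]_(k, n - k)).

Definition pivot_mx b : 'M[K]_(k, n) := rowsub (tnth b) 1%:M.
Definition nonpivot_mx b : 'M[K]_(n - k, n) := rowsub (perp_elt b) 1%:M.

Lemma mul_rowsub1_tr p q r (f : 'I_p -> 'I_r) (g : 'I_q -> 'I_r) :
  rowsub f 1%:M *m (rowsub g 1%:M)^T = \matrix_(i, j) ((f i == g j)%:R : K).
Proof.
rewrite mul_rowsub_mx mul1mx; apply/matrixP => i j.
by rewrite !mxE eq_sym.
Qed.

Lemma pivot_mxK b : pivot_mx b *m (pivot_mx b)^T = 1%:M.
Proof.
rewrite mul_rowsub1_tr; apply/matrixP => i j.
by rewrite !mxE (inj_eq (@tnth_sc_inj _ _ b)).
Qed.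

Lemma nonpivot_mxK b : nonpivot_mx b *m (nonpivot_mx b)^T = 1%:M.
Proof.
rewrite mul_rowsub1_tr; apply/matrixP => i j.
by rewrite !mxE (inj_eq (@perp_elt_inj _ _ b)).
Qed.

Lemma nonpivot_mx_pivot b : nonpivot_mx b *m (pivot_mx b)^T = 0.
Proof.
by rewrite mul_rowsub1_tr; apply/matrixP => i j; rewrite !mxE perp_elt_neq.
Qed.

Lemma pivot_mx_nonpivot b : pivot_mx b *m (nonpivot_mx b)^T = 0.
Proof. by rewrite -[LHS]trmxK trmx_mul trmxK nonpivot_mx_pivot trmx0. Qed.

Lemma pivot_nonpivot_decomp b :
  (pivot_mx b)^T *m pivot_mx b + (nonpivot_mx b)^T *m nonpivot_mx b = 1%:M.
Proof.
rewrite -[RHS](mul1mx 1%:M) -{1}trmx1; apply/matrixP => c d; rewrite !mxE.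
rewrite (big_sc_perp +%R b).
by congr (_ + _); apply: eq_bigr => i _; rewrite !mxE.
Qed.

Lemma mul_tr_pivot_mx b p (A : 'M[K]_(p, n)) :
  A *m (pivot_mx b)^T = colsub (tnth b) A.
Proof. by rewrite trmx_mxsub trmx1 mulmx_colsub mulmx1. Qed.

Lemma mul_tr_nonpivot_mx b p (A : 'M[K]_(p, n)) :
  A *m (nonpivot_mx b)^T = colsub (perp_elt b) A.
Proof. by rewrite trmx_mxsub trmx1 mulmx_colsub mulmx1. Qed.

Lemma mul_pivot_mx b p (A : 'M[K]_(n, p)) :
  pivot_mx b *m A = rowsub (tnth b) A.
Proof. by rewrite mul_rowsub_mx mul1mx. Qed.

Lemma mul_nonpivot_mx b p (A : 'M[K]_(n, p)) :
  nonpivot_mx b *m A = rowsub (perp_elt b) A.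
Proof. by rewrite mul_rowsub_mx mul1mx. Qed.

Definition slopes b : set 'M[K]_(k, n - k) :=
  [set X | forall i j, ~~ descent b (i, j) -> X i j = 0].

Definition row_chart b X : 'M[K]_(k, n) := pivot_mx b + X *m nonpivot_mx b.

Definition col_chart b X : 'M[K]_(n, n - k) :=
  (nonpivot_mx b)^T - (pivot_mx b)^T *m X.

Lemma mul_row_chart_tr_pivot b X : row_chart b X *m (pivot_mx b)^T = 1%:M.
Proof. by rewrite mulmxDl pivot_mxK -mulmxA nonpivot_mx_pivot mulmx0 addr0. Qed.

Lemma mul_row_chart_tr_nonpivot b X : row_chart b X *m (nonpivot_mx b)^T = X.
Proof.
by rewrite mulmxDl pivot_mx_nonpivot -mulmxA nonpivot_mxK mulmx1 add0r.
Qed.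

Lemma mul_nonpivot_col_chart b X : nonpivot_mx b *m col_chart b X = 1%:M.
Proof.
by rewrite mulmxBr nonpivot_mxK mulmxA nonpivot_mx_pivot mul0mx subr0.
Qed.

Lemma mul_pivot_col_chart b X : pivot_mx b *m col_chart b X = - X.
Proof. by rewrite mulmxBr pivot_mx_nonpivot mulmxA pivot_mxK mul1mx sub0r. Qed.

Lemma mul_row_chart_col_chart b X Y : row_chart b X *m col_chart b Y = X - Y.
Proof.
rewrite mulmxDl -mulmxA mul_pivot_col_chart mul_nonpivot_col_chart.
by rewrite mulmx1 addrC.
Qed.

Lemma row_free_row_chart b X : row_free (row_chart b X).
Proof.
by apply/row_freeP; exists (pivot_mx b)^T; apply: mul_row_chart_tr_pivot.
Qed.

Lemma mxrank_col_chart b X : \rank (col_chart b X) = (n - k)%N.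
Proof.
apply/eqP; rewrite -mxrank_tr; apply/row_freeP; exists (nonpivot_mx b)^T.
by rewrite -trmx_mul mul_nonpivot_col_chart trmx1.
Qed.

Lemma S_spaceP b (M : 'M[K]_(k, n)) :
  S_space b M <-> exists2 X, slopes b X & M = row_chart b X.
Proof.
split=> [[M_id M_0]|[X X0 ->]]; last split=> [i j|i c lt_ic].
- have MP : M *m (pivot_mx b)^T = 1%:M.
    by rewrite mul_tr_pivot_mx; apply/matrixP => i j; rewrite !mxE.
  exists (M *m (nonpivot_mx b)^T) => [i j|].
    by rewrite descentNE mul_tr_nonpivot_mx mxE; apply: M_0.
  by rewrite -[LHS]mulmx1 -(pivot_nonpivot_decomp b) mulmxDr !mulmxA MP mul1mx.
- have /matrixP/(_ i j) := mul_row_chart_tr_pivot b X.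
  by rewrite mul_tr_pivot_mx !mxE.
have [[j cE]|[j cE]] := tnth_or_perp_elt b c; rewrite cE in lt_ic *.
  have /matrixP/(_ i j) := mul_row_chart_tr_pivot b X.
  rewrite mul_tr_pivot_mx !mxE => ->.
  by case: eqP lt_ic => // ->; rewrite ltnn.
have /matrixP/(_ i j) := mul_row_chart_tr_nonpivot b X.
by rewrite mul_tr_nonpivot_mx mxE => ->; rewrite X0 // descentNE.
Qed.

Lemma Shat_spaceP b (N : 'M[K]_(n, n - k)) :
  Shat_space (sc_perp b) N <-> exists2 X, slopes b X & N = col_chart b X.
Proof.
split=> [[N_id N_0]|[X X0 ->]]; last split=> [i j|r j lt_rj].
- have QN : nonpivot_mx b *m N = 1%:M.
    by rewrite mul_nonpivot_mx; apply/matrixP => i j; rewrite !mxE; apply: N_id.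
  exists (- (pivot_mx b *m N)) => [i j|].
    by rewrite descentNE mul_pivot_mx !mxE => /N_0 ->; rewrite oppr0.
  rewrite /col_chart mulmxN opprK -[LHS]mul1mx -(pivot_nonpivot_decomp b).
  by rewrite mulmxDl -!mulmxA QN mulmx1 addrC.
- have /matrixP/(_ i j) := mul_nonpivot_col_chart b X.
  by rewrite mul_nonpivot_mx !mxE.
have [[i rE]|[i rE]] := tnth_or_perp_elt b r; rewrite rE in lt_rj *.
  have /matrixP/(_ i j) := mul_pivot_col_chart b X.
  by rewrite mul_pivot_mx !mxE => ->; rewrite X0 ?oppr0 // descentNE.
have /matrixP/(_ i j) := mul_nonpivot_col_chart b X.
rewrite mul_nonpivot_mx !mxE => ->.
by case: eqP lt_rj => // ->; rewrite ltnn.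
Qed.

Lemma S_space_free b (M : 'M[K]_(k, n)) : S_space b M -> row_free M.
Proof. by move=> /S_spaceP[X _ ->]; apply: row_free_row_chart. Qed.

Lemma S_space_rowspace_inj b (A : 'M[K]_n) (M M' : 'M[K]_(k, n)) :
    A \in unitmx -> S_space b M -> S_space b M' ->
  rowspace (M *m A) = rowspace (M' *m A) -> M = M'.
Proof.
move=> A_unit /S_spaceP[X _ ->] /S_spaceP[X' _ ->] /rowspace_eq eqXX'.
have /submxP[g] : (row_chart b X *m A <= row_chart b X' *m A)%MS.
  by rewrite eqXX'.
rewrite mulmxA => /(can_inj (mulmxK A_unit)) gE.
have /(congr1 (mulmx^~ (pivot_mx b)^T)) := gE.
rewrite -mulmxA !mul_row_chart_tr_pivot mulmx1 => g1.
by rewrite gE -g1 mul1mx.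
Qed.

Lemma Shat_space_colspace_inj b (A : 'M[K]_n) (N N' : 'M[K]_(n, n - k)) :
    A \in unitmx -> Shat_space (sc_perp b) N -> Shat_space (sc_perp b) N' ->
  colspace (A *m N) = colspace (A *m N') -> N = N'.
Proof.
move=> A_unit /Shat_spaceP[X _ ->] /Shat_spaceP[X' _ ->] /colspace_eq eqXX'.
have /submxP[g] : ((A *m col_chart b X)^T <= (A *m col_chart b X')^T)%MS.
  by rewrite eqXX'.
move=> /(canRL trmxK); rewrite trmx_mul trmxK -mulmxA.
move=> /(can_inj (mulKmx A_unit)) gE.
have /(congr1 (mulmx (nonpivot_mx b))) := gE.
rewrite mulmxA !mul_nonpivot_col_chart mul1mx => g1.
by rewrite gE -g1 mulmx1.
Qed.

End Charts.

Section EchelonForm.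
Variables (K : fieldType) (n k : nat).
Implicit Types (b : schubert_cond n k) (W M : 'M[K]_(k, n)).

Lemma unit_minor_inj W (f : 'I_k -> 'I_n) :
  colsub f W \in unitmx -> injective f.
Proof.
move=> Wf_unit i j eq_f.
have : colsub f W *m delta_mx i (0 : 'I_1) = colsub f W *m delta_mx j 0.
  by rewrite -!colE !col_colsub eq_f.
move/(can_inj (mulKmx Wf_unit))/matrixP/(_ i 0); rewrite !mxE !eqxx andbT.
by case: eqP => // _ /eqP; rewrite oner_eq0.
Qed.

Lemma sort_unit_minor W (f : 'I_k -> 'I_n) : colsub f W \in unitmx ->
  exists2 b : schubert_cond n k,
    colsub (tnth b) W \in unitmx & (\sum_i tnth b i = \sum_i f i)%N.
Proof.
move=> Wf_unit; have [b [s bE]] := sc_of_injective (unit_minor_inj Wf_unit).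
exists b; last first.
  by under eq_bigr do rewrite bE; rewrite [RHS](reindex_inj (@perm_inj _ s)).
rewrite (@eq_colsub _ _ _ _ _ (f \o s) bE) (colsub_comp f) -col_permEsub.
by rewrite col_permE unitmx_mul Wf_unit unitmx_perm.
Qed.

Lemma exists_unit_minor W :
  row_free W -> exists b, colsub (tnth b) W \in unitmx.
Proof.
rewrite /row_free -mxrank_tr => W_free.
have := fullrowsub_unit (W_free : row_full W^T).
by rewrite -trmx_mxsub unitmx_tr => /sort_unit_minor[b]; exists b.
Qed.

(* Column [j <> i] of the new minor is still the unit vector [e_j]. *)
Lemma exchange_unit_minor b M i c : colsub (tnth b) M = 1%:M -> M i c != 0 ->
  colsub [eta tnth b with i |-> c] M \in unitmx.
Proof.
move=> Mb Mic; rewrite -row_free_unit -kermx_eq0; apply/rowV0P => x /sub_kermxP.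
rewrite mulmx_colsub => xM0.
have x0 j : j != i -> x 0 j = 0.
  move=> neq_ji; have /rowP/(_ j) := xM0; rewrite !mxE /= (negPf neq_ji) => <-.
  have /rowP/(_ j) : colsub (tnth b) (x *m M) = x.
    by rewrite -mulmx_colsub Mb mulmx1.
  by rewrite !mxE.
apply/rowP => j; rewrite [RHS]mxE; have [->|/x0//] := eqVneq j i.
have /rowP/(_ i) := xM0; rewrite !mxE /= eqxx (bigD1 i) //= big1 => [|l /x0->].
  by rewrite addr0 => /eqP; rewrite mulf_eq0 (negPf Mic) orbF => /eqP.
by rewrite mul0r.
Qed.

(* The pivot columns are those of a nonzero maximal minor with the largest
   possible sum of column indices: a nonzero entry to the right of its pivot
   could be exchanged against the pivot. *)
Lemma echelon_form W : row_free W -> exists b M, S_space b M /\ (M :=: W)%MS.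
Proof.
case/exists_unit_minor => b0 Wb0; pose weight b := (\sum_i tnth b i)%N.
pose unit_minor b := colsub (tnth b) W \in unitmx.
have [b Wb b_max] := @arg_maxnP _ b0 unit_minor weight Wb0.
pose M := invmx (colsub (tnth b) W) *m W.
have Mb : colsub (tnth b) M = 1%:M by rewrite -mulmx_colsub mulVmx.
have WE : W = colsub (tnth b) W *m M by rewrite mulKVmx.
exists b, M; split; last by apply: eqmxMfull; rewrite row_full_unit unitmx_inv.
split=> [i j|i c lt_ic]; first by have /matrixP/(_ i j) := Mb; rewrite !mxE.
have [//|/(exchange_unit_minor Mb)] := eqVneq (M i c) 0.
set f := [eta _ with _ |-> _] => Mf.
have /sort_unit_minor[b' Wb' sum_b'] : colsub f W \in unitmx.
  by rewrite [X in colsub _ X]WE -mulmx_colsub unitmx_mul; apply/andP; split.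
have := b_max b' Wb'; rewrite /weight sum_b' /= leqNgt => /negP[].
rewrite [X in (X < _)%N](bigD1 i) //= [X in (_ < X)%N](bigD1 i) //= eqxx.
rewrite -addSn leq_add // leq_eqVlt; apply/orP; left; apply/eqP.
by apply: eq_bigr => j /negPf /= ->.
Qed.

End EchelonForm.

(** * Flags and Schubert varieties *)

Section Flags.
Variables (K : fieldType) (n : nat).
Implicit Types (F G : flag K n) (A L : 'M[K]_n).

Definition lead_rows A (i : nat) : {vspace 'rV[K]_n} :=
  <<[seq row j A | j : 'I_n <- enum 'I_n & (j < i)%N]>>%VS.

Lemma row_lead_rows A (i : nat) (j : 'I_n) :
  (j < i)%N -> row j A \in lead_rows A i.
Proof.
move=> lt_ji; apply/memv_span/(map_f (fun j => row j A)).
by rewrite mem_filter lt_ji mem_enum.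
Qed.

Lemma mem_lead_rowsP A (i : nat) (v : 'rV[K]_n) : A \in unitmx ->
  reflect (forall j : 'I_n, (i <= j)%N -> (v *m invmx A) 0 j = 0)
          (v \in lead_rows A i).
Proof.
move=> A_unit; apply: (iffP (mem_span_rowsP _ _ _)) => [[x x0 ->] j|v0].
  by rewrite mulmxK // leqNgt; apply: x0.
by exists (v *m invmx A) => [j|]; rewrite ?mulmxKV // -leqNgt; apply: v0.
Qed.

Lemma dim_lead_rows A :
  A \in unitmx -> forall i : 'I_n.+1, \dim (lead_rows A i) = i.
Proof.
move=> A_unit i.
by rewrite dim_span_rows ?row_free_unit // card_ord_ltn ?leq_ord.
Qed.

Lemma lead_rows_sub A (i j : 'I_n.+1) :
  (i <= j)%N -> (lead_rows A i <= lead_rows A j)%VS.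
Proof.
move=> le_ij; apply/span_subvP => v /mapP[l].
rewrite mem_filter => /andP[lt_li _] ->.
exact/row_lead_rows/(leq_trans lt_li).
Qed.

Definition rows_flag A (A_unit : A \in unitmx) : flag K n :=
  Flag (dim_lead_rows A_unit) (@lead_rows_sub A).

Lemma flag_subv_eq F G : (forall i, (F i <= G i)%VS) -> forall i, F i = G i.
Proof. by move=> subFG i; apply/eqP; rewrite eqEdim subFG !flag_dim leqnn. Qed.

Lemma mem_flagP F A (i : 'I_n.+1) (v : 'rV[K]_n) : flag_matrix F A ->
  reflect (forall j : 'I_n, (i <= j)%N -> (v *m invmx A) 0 j = 0) (v \in F i).
Proof. by case=> A_unit <-; apply: mem_lead_rowsP. Qed.

Lemma flag_matrix_trans F A A' : flag_matrix F A -> flag_matrix F A' ->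
  is_trig_mx (A' *m invmx A).
Proof.
move=> FA [_ FA']; apply/is_trig_mxP => i j lt_ij.
have : row i A' \in F (lift ord0 i) by rewrite -FA'; apply: row_lead_rows.
by move/(mem_flagP _ _ FA)/(_ j); rewrite -row_mul mxE; apply.
Qed.

Lemma flag_matrix_trig F A L : flag_matrix F A ->
  is_trig_mx L -> L \in unitmx -> flag_matrix F (L *m A).
Proof.
move=> FA /is_trig_mxP L_trig L_unit; have [A_unit _] := FA.
have LA_unit : L *m A \in unitmx by rewrite unitmx_mul L_unit.
split=> //; apply: (flag_subv_eq (F := rows_flag LA_unit)) => i.
apply/span_subvP => v /mapP[l]; rewrite mem_filter => /andP[lt_li _] ->.
apply/(mem_flagP _ _ FA) => j le_ij; rewrite row_mul mulmxK // mxE.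
exact/L_trig/(leq_trans lt_li).
Qed.

Lemma dual_flag_matrix_inv F A :
  dual_flag_matrix F A -> flag_matrix F (invmx A).
Proof.
case=> A_unit FA; have invA_unit : invmx A \in unitmx by rewrite unitmx_inv.
split=> // i; apply/esym/(flag_subv_eq (G := rows_flag invA_unit)) => {}i.
apply/subvP => v vF; apply/(mem_lead_rowsP _ _ invA_unit) => j le_ij.
rewrite invmxK.
have : col j A \in annih (F i).
  rewrite -[i in F i]rev_ordK -FA; apply/memv_span/(map_f (fun j => col j A)).
  by rewrite mem_filter mem_enum andbT /= subSS subKn // -ltnS.
move/annihP/(_ v vF)/matrixP/(_ 0 0); rewrite [RHS]mxE => <-.
by rewrite !mxE; apply: eq_bigr => l _; rewrite !mxE.
Qed.

End Flags.

Section SchubertCells.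
Variables (K : fieldType) (n k : nat).
Implicit Types (F : flag K n) (A : 'M[K]_n) (b : schubert_cond n k)
  (M : 'M[K]_(k, n)) (H : {vspace 'rV[K]_n}).

Lemma row_free_mulmx_unit M A : A \in unitmx -> row_free (M *m A) = row_free M.
Proof. by move=> A_unit; rewrite /row_free mxrankMfree ?row_free_unit. Qed.

Lemma dim_cap_flag F A b M (i : 'I_n.+1) : flag_matrix F A -> S_space b M ->
  \dim (rowspace (M *m A) :&: F i) = #|[pred j | (tnth b j < i)%N]|.
Proof.
move=> FA MS; have [A_unit _] := FA; have /S_spaceP[X _ ME] := MS.
have MA_free : row_free (M *m A).
  by rewrite row_free_mulmx_unit ?(S_space_free MS).
rewrite -(dim_span_rows _ MA_free); congr (\dim _); apply/vspaceP => v.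
rewrite memv_cap mem_rowspace.
apply/andP/mem_span_rowsP => [[/submxP[x vE] /(mem_flagP _ _ FA) v0]|[x x0 vE]].
  exists x => // j; rewrite -leqNgt => /v0; rewrite vE mulmxA mulmxK // => <-.
  rewrite -[x in LHS]mulmx1 -(mul_row_chart_tr_pivot b X) -ME mulmxA.
  by rewrite mul_tr_pivot_mx mxE.
rewrite vE submxMl; split=> //; apply/(mem_flagP _ _ FA) => c le_ic.
rewrite mulmxA mulmxK // mxE big1 // => j _.
have [lt_ji|le_ij] := ltnP (tnth b j) i; last by rewrite x0 ?mul0r //= -leqNgt.
by case: MS => _ ->; rewrite ?mulr0 // (leq_trans lt_ji).
Qed.

Lemma dim_open_schubert F b H : open_schubert b F H -> \dim H = k.
Proof.
case=> A [M [[A_unit _] MS ->]]; rewrite dim_rowspace.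
by apply/eqP; rewrite -/(row_free _) row_free_mulmx_unit ?(S_space_free MS).
Qed.

Lemma open_schubert_variety F b b' H : open_schubert b F H ->
  schubert_variety b' F H <-> forall i, (tnth b i <= tnth b' i)%N.
Proof.
move=> bH; have Hk := dim_open_schubert bH; have [A [M [FA MS HE]]] := bH.
have dim_gt (i : 'I_k) :
    (i < \dim (H :&: F (lift ord0 (tnth b' i))))%N = (tnth b i <= tnth b' i)%N.
  by rewrite HE (dim_cap_flag _ FA MS) ltn_card_sc /= ltnS.
by split=> [[_ gt] i|le_bb']; [rewrite -dim_gt | split=> // i; rewrite dim_gt].
Qed.

Lemma open_schubert_inj F b b' H :
  open_schubert b F H -> open_schubert b' F H -> b = b'.
Proof.
have le_tnth (c c' : schubert_cond n k) :
    open_schubert c F H -> open_schubert c' F H ->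
    forall i, (tnth c i <= tnth c' i)%N.
  move=> cH c'H i; apply: (open_schubert_variety c' cH).1.
  by apply/(open_schubert_variety c' c'H).
move=> bH b'H; apply/val_inj/eq_from_tnth => i; apply/val_inj/eqP.
by rewrite /= eqn_leq !le_tnth.
Qed.

Lemma rowspace_echelon A H : A \in unitmx -> \dim H = k ->
  exists b M, S_space b M /\ H = rowspace (M *m A).
Proof.
move=> A_unit /vspace_rowspace[h h_free ->].
have hA_free : row_free (h *m invmx A).
  by rewrite row_free_mulmx_unit ?unitmx_inv.
have [b [M [MS ME]]] := echelon_form hA_free; exists b, M; split=> //.
apply/rowspace_eq/eqmx_sym.
by rewrite -[h in (_ :=: h)%MS](mulmxKV A_unit); apply: eqmxMr.
Qed.

Lemma exists_open_schubert F A H : flag_matrix F A -> \dim H = k ->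
  exists b, open_schubert b F H.
Proof.
move=> FA Hk; have [b [M [MS HE]]] := rowspace_echelon FA.1 Hk.
by exists b, A, M.
Qed.

Lemma open_schubertP F A b H : flag_matrix F A ->
  open_schubert b F H <-> exists2 M, S_space b M & H = rowspace (M *m A).
Proof.
move=> FA; split=> [bH|[M MS HE]]; last by exists A, M.
have [b' [M [MS HE]]] := rowspace_echelon FA.1 (dim_open_schubert bH).
suff -> : b = b' by exists M.
by apply: open_schubert_inj bH _; exists A, M.
Qed.

Lemma mxrank_charts A A' b b' (X X' : 'M[K]_(k, n - k)) :
    A \in unitmx -> A' \in unitmx ->
  (\rank (row_chart b X *m A) + \rank (A' *m col_chart b' X') = n)%N.
Proof.
move=> A_unit A'_unit.
rewrite (eqmxMfull _ (_ : row_full A')) ?row_full_unit // mxrank_col_chart.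
rewrite mxrankMfree ?row_free_unit // (eqP (row_free_row_chart b X)).
by rewrite subnKC ?(leq_sc_size b).
Qed.

Lemma annih_row_chart A b (X : 'M[K]_(k, n - k)) : A \in unitmx ->
  annih (rowspace (row_chart b X *m invmx A)) = colspace (A *m col_chart b X).
Proof.
move=> A_unit; apply/annih_colspaceP.
  by rewrite mxrank_charts ?unitmx_inv.
by rewrite mulmxA mulmxKV // mul_row_chart_col_chart subrr.
Qed.

Lemma open_schubert_annih F A b H : dual_flag_matrix F A ->
  open_schubert b F H <-> exists2 N : 'M[K]_(n, n - k),
    Shat_space (sc_perp b) N & annih H = colspace (A *m N).
Proof.
move=> dualA; have [A_unit _] := dualA; have FA := dual_flag_matrix_inv dualA.
split=> [/(open_schubertP _ _ FA)[_ /S_spaceP[X XS ->] ->]|[N]].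
  exists (col_chart b X); first by apply/Shat_spaceP; exists X.
  exact: annih_row_chart.
move=> /Shat_spaceP[X XS ->]; rewrite -annih_row_chart // => /annih_inj ->.
apply/(open_schubertP _ _ FA).
by exists (row_chart b X) => //; apply/S_spaceP; exists X.
Qed.

End SchubertCells.

(** * The bilinear system *)

Section SlopeParameters.
Variables (K : fieldType) (n k q : nat) (b : 'I_q -> schubert_cond n k).

Definition slope_index : finType :=
  {t : 'I_q * ('I_k * 'I_(n - k)) | descent (b t.1) t.2}.

Definition slope_params : vectType K := {ffun slope_index -> K^o}.

Definition slope_mx (i : 'I_q) (y : slope_params) : 'M[K]_(k, n - k) :=
  \matrix_(r, c) if insub (i, (r, c)) is Some t then y t else 0.

Lemma slope_mx_linear i : linear (slope_mx i).
Proof.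
move=> x u v; apply/matrixP => r c; rewrite !mxE.
by case: insubP => [t _ _|_]; rewrite ?ffunE // mulr0 addr0.
Qed.

HB.instance Definition _ i :=
  GRing.isLinear.Build _ _ _ _ (slope_mx i) (slope_mx_linear i).

Lemma slope_mx_slopes i y : slopes (b i) (slope_mx i y).
Proof. by move=> r c ndesc_rc; rewrite mxE insubF //=; apply/negbTE. Qed.

Lemma slope_mx_inj y y' : (forall i, slope_mx i y = slope_mx i y') -> y = y'.
Proof.
move=> eq_yy'; apply/ffunP => -[[i [r c]] desc_rc].
by have /matrixP/(_ r c) := eq_yy' i; rewrite !mxE insubT.
Qed.

Lemma slope_mx_surj (X : 'I_q -> 'M[K]_(k, n - k)) :
  (forall i, slopes (b i) (X i)) -> exists y, forall i, slope_mx i y = X i.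
Proof.
move=> XS; exists [ffun t => X (val t).1 (val t).2.1 (val t).2.2] => i.
apply/matrixP => r c; rewrite mxE; case: insubP => [t _ tE|ndesc_rc].
  by rewrite ffunE tE.
by rewrite XS.
Qed.

Lemma dim_slope_params :
  (\dim {: slope_params} + total_codim b = k * (n - k) * q)%N.
Proof.
have -> : \dim {: slope_params} = #|slope_index| by rewrite dimvf -[RHS]muln1.
rewrite card_sig card_sum_pred.
rewrite -(pair_bigA _ (fun i p => nat_of_bool (descent (b i) p))) /=.
rewrite -big_split /= (eq_bigr (fun=> k * (n - k))%N) => [|i _].
  by rewrite sum_nat_const card_ord mulnC.
by rewrite -card_sum_pred card_descentE subnK // leq_codim.
Qed.

End SlopeParameters.

Section BilinearSystem.
Variables (K : fieldType) (n k m : nat) (a : 'I_m.+1 -> schubert_cond n k).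
Implicit Types x : unknowns K n k m.

Definition charts (y : slope_params K a) : unknowns K n k m :=
  (row_chart (a ord0) (slope_mx ord0 y),
   [ffun l => col_chart (a (lift ord0 l)) (slope_mx (lift ord0 l) y)]).

Lemma charts_inj : injective charts.
Proof.
move=> y y' [eq0 /ffunP eqS]; apply: slope_mx_inj => i.
case: (unliftP ord0 i) => [l ->|->]; last first.
  by rewrite -(mul_row_chart_tr_nonpivot (a ord0) (slope_mx ord0 y)) eq0
    mul_row_chart_tr_nonpivot.
apply: oppr_inj; have := eqS l; rewrite !ffunE => eql.
by rewrite -(mul_pivot_col_chart (a (lift ord0 l))) eql mul_pivot_col_chart.
Qed.

Lemma charts_affine : linear (fun y => charts y - charts 0).
Proof.
move=> c y z; congr (_, _); last apply/ffunP => l.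
  rewrite /= /row_chart !linear0 mul0mx addr0 !(addrC (pivot_mx _ _)) !addrK.
  by rewrite linearP mulmxDl scalemxAl.
rewrite !ffunE /= /col_chart !linear0 addr0.
rewrite !(addrC (trmx (nonpivot_mx _ _))) !addrK.
by rewrite linearP mulmxDr -scalemxAr opprD scalerN.
Qed.

Lemma coordinates_range : coordinates a = range charts.
Proof.
apply/seteqP; split=> [x [/S_spaceP[X0 X0S xE] xS]|_ [y _ <-]].
  have /choice[X XS] : forall l, exists X : 'M[K]_(k, n - k),
      slopes (a (lift ord0 l)) X /\ x.2 l = col_chart (a (lift ord0 l)) X.
    by move=> l; have /Shat_spaceP[X] := xS l; exists X.
  pose Y i := if unlift ord0 i is Some l then X l else X0.
  have [|y yE] := @slope_mx_surj K _ _ _ a Y.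
    move=> i; rewrite /Y; case: (unliftP ord0 i) => [l ->|-> //].
    by have [] := XS l.
  exists y => //; apply: injective_projections => /=.
    by rewrite yE /Y unlift_none xE.
  by apply/ffunP => l; rewrite ffunE yE /Y liftK; have [_ ->] := XS l.
split=> [|l].
  by apply/S_spaceP; exists (slope_mx ord0 y) => //; apply: slope_mx_slopes.
rewrite /= ffunE; apply/Shat_spaceP; exists (slope_mx (lift ord0 l) y) => //.
exact: slope_mx_slopes.
Qed.

Lemma coordinates_affine :
  affine_space_of_dim (@coordinates K n k m a)
    (k * (n - k) * m.+1 - total_codim a).
Proof.
rewrite coordinates_range -(dim_slope_params K a) addnK.
exact: affine_space_range charts_affine charts_inj.
Qed.

Section Equations.
Variables (F1 : 'M[K]_n) (Fhat : 'I_m -> 'M[K]_n).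

Lemma bilin_eqn_bilinear (e : eqn_index n k m) :
  bilinear_for *%R *%R (bilin_eqn F1 Fhat e).
Proof.
split=> [N c M M'|M c N N'] /=; rewrite /bilin_eqn.
  by rewrite !mulmxDl -!scalemxAl !mxE.
by rewrite mulmxDr -scalemxAr !mxE.
Qed.

Lemma solutions_eqns :
  solutions a F1 Fhat = [set x | coordinates a x /\
    forall e : eqn_index n k m, bilin_eqn F1 Fhat e x.1 (x.2 e.1.1) = 0].
Proof.
apply/seteqP; split=> x [xC eqs]; split=> //.
  by move=> [[i r] c]; rewrite /bilin_eqn /= eqs mxE.
by move=> i; apply/matrixP => r c; rewrite [RHS]mxE; apply: (eqs (i, r, c)).
Qed.

Lemma card_eqn_index : #|eqn_index n k m| = (k * (n - k) * m)%N.
Proof. by rewrite !card_prod !card_ord -mulnA mulnC. Qed.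

Hypotheses (F1_unit : F1 \in unitmx) (Fhat_unit : forall i, Fhat i \in unitmx).

Lemma solutions_annih x : coordinates a x ->
  solutions a F1 Fhat x <->
  subspaces_of F1 Fhat x = dual_diagonal m (rowspace (x.1 *m F1)).
Proof.
move=> xC; have [xS xhatS] := xC.
have annihE i : annih (rowspace (x.1 *m F1)) = colspace (Fhat i *m x.2 i) <->
    x.1 *m F1 *m Fhat i *m x.2 i = 0.
  have /S_spaceP[X _ ->] := xS; have /Shat_spaceP[Y _ ->] := xhatS i.
  by rewrite -[X in X = 0]mulmxA; apply/annih_colspaceP/mxrank_charts.
split=> [[_ eqs]|[/ffunP diag]].
  by congr (_, _); apply/ffunP => i; rewrite !ffunE; apply/esym/annihE.
by split=> // i; apply/annihE; have := diag i; rewrite !ffunE.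
Qed.

Lemma subspaces_of_inj : {in coordinates a &, injective (subspaces_of F1 Fhat)}.
Proof.
move=> [M N] [M' N'] /set_mem[/= MS NS] /set_mem[/= M'S N'S] [eqM /ffunP eqN].
congr (_, _); first exact: (S_space_rowspace_inj F1_unit MS M'S eqM).
apply/ffunP => i; apply: (Shat_space_colspace_inj (Fhat_unit i) (NS i) (N'S i)).
by have := eqN i; rewrite !ffunE.
Qed.

End Equations.

Lemma solutions_bij (F : 'I_m.+1 -> flag K n) (F1 : 'M[K]_n)
    (Fhat : 'I_m -> 'M[K]_n) :
    flag_matrix (F ord0) F1 ->
    (forall i : 'I_m, dual_flag_matrix (F (lift ord0 i)) (Fhat i)) ->
  set_bij (solutions a F1 Fhat)
    (dual_diagonal m @` (\bigcap_i open_schubert (a i) (F i)))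
    (subspaces_of F1 Fhat).
Proof.
move=> FF1 FFhat; have [F1_unit _] := FF1.
have Fhat_unit i : Fhat i \in unitmx by have [] := FFhat i.
split.
- move=> x xsol; have [xC _] := xsol; have [xS xhatS] := xC.
  have /(solutions_annih F1_unit Fhat_unit xC) diag := xsol.
  exists (rowspace (x.1 *m F1)); last by rewrite diag.
  move=> i _; case: (unliftP ord0 i) => [j ->|->]; last by exists F1, x.1.
  apply/(open_schubert_annih _ _ (FFhat j)); exists (x.2 j) => //.
  by have [/ffunP/(_ j)] := diag; rewrite !ffunE.
- move=> x x' /set_mem[/mem_set xC _] /set_mem[/mem_set x'C _].
  exact: (subspaces_of_inj F1_unit Fhat_unit xC x'C).
- move=> _ [H HX <-].
  have /(open_schubertP _ _ FF1)[M MS HE] := HX ord0 I.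
  have /choice[N NS] : forall i : 'I_m, exists N : 'M[K]_(n, n - k),
      Shat_space (sc_perp (a (lift ord0 i))) N /\
      annih H = colspace (Fhat i *m N).
    move=> i.
    have /(open_schubert_annih _ _ (FFhat i))[N] := HX (lift ord0 i) I.
    by exists N.
  have xC : coordinates a (M, [ffun i => N i]).
    by split=> //= i; rewrite ffunE; have [] := NS i.
  have diag : subspaces_of F1 Fhat (M, [ffun i => N i]) = dual_diagonal m H.
    rewrite /subspaces_of -HE; congr (_, _); apply/ffunP => i.
    by rewrite !ffunE; have [_ ->] := NS i.
  by exists (M, [ffun i => N i]); rewrite // (solutions_annih F1_unit) // -HE.
Qed.

End BilinearSystem.

(** * General flags *)

Section GeneralPosition.
Variables (K : fieldType) (n k m : nat).

Section CommonSubspace.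
Variables (b : 'I_m -> schubert_cond n k) (c : schubert_cond n k).

Definition incidence_params : vectType K :=
  ({ffun 'I_m -> 'M[K]_k * 'M[K]_(n - k, n)} * slope_params K b *
   'M[K]_(k, n - k))%type.

(* The matrix [A] with non-pivot rows [B] such that
   [row_chart b X *m A = g *m h]. *)
Definition incidence_mx (v : incidence_params) (i : 'I_m) : 'M[K]_n :=
  let: (g, B) := v.1.1 i in
  (pivot_mx K (b i))^T *m (g *m row_chart c v.2 - slope_mx i v.1.2 *m B) +
  (nonpivot_mx K (b i))^T *m B.

Lemma dim_incidence_params :
  (\dim {: incidence_params} + total_codim b = m * n * n + k * (n - k))%N.
Proof.
have -> : \dim {: incidence_params} =
    (#|'I_m| * (k * k + (n - k) * n) + \dim {: slope_params K b}
     + k * (n - k))%N.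
  by rewrite !dimvf.
have le_kn := leq_sc_size c.
rewrite card_ord addnAC -[(_ + _ + total_codim b)%N]addnA dim_slope_params.
congr (_ + _)%N; rewrite [X in (_ + X)%N]mulnC -mulnDr -mulnA; congr (_ * _)%N.
by rewrite addnAC -mulnDr subnKC // -mulnDl subnKC.
Qed.

Lemma polynomial_incidence_mx i : polynomial_mx (incidence_mx ^~ i).
Proof.
have -> : incidence_mx ^~ i = fun v => (pivot_mx K (b i))^T *m
    ((v.1.1 i).1 *m row_chart c v.2 - slope_mx i v.1.2 *m (v.1.1 i).2) +
    (nonpivot_mx K (b i))^T *m (v.1.1 i).2.
  by apply/funext => v; rewrite /incidence_mx; case: (v.1.1 i).
have g_poly : polynomial_mx (fun v : incidence_params => (v.1.1 i).1).
  by apply: polynomial_mx_linear => x u v; rewrite /= !ffunE.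
have B_poly : polynomial_mx (fun v : incidence_params => (v.1.1 i).2).
  by apply: polynomial_mx_linear => x u v; rewrite /= !ffunE.
have X_poly : polynomial_mx (fun v : incidence_params => slope_mx i v.1.2).
  by apply: polynomial_mx_linear => x u v; rewrite /= linearP.
have h_poly : polynomial_mx (fun v : incidence_params => row_chart c v.2).
  apply: polynomial_mxD; first exact: polynomial_mx_cst.
  apply: polynomial_mxM; last exact: polynomial_mx_cst.
  by apply: polynomial_mx_linear.
apply: polynomial_mxD; last first.
  exact: polynomial_mxM (polynomial_mx_cst _ _) B_poly.
apply: polynomial_mxM; first exact: polynomial_mx_cst.
by apply: polynomial_mxB; apply: polynomial_mxM.
Qed.

Lemma incidence_mx_cover (A : 'I_m -> 'M[K]_n) (h : 'M[K]_(k, n)) :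
    S_space c h ->
    (forall i, exists2 M, S_space (b i) M & (M *m A i <= h)%MS) ->
  exists v, forall i, incidence_mx v i = A i.
Proof.
move=> /S_spaceP[Y _ ->] Mh.
have /choice[gX gXP] i : exists gX : 'M[K]_k * 'M[K]_(k, n - k),
    slopes (b i) gX.2 /\ row_chart (b i) gX.2 *m A i = gX.1 *m row_chart c Y.
  by have [_ /S_spaceP[X XS ->] /submxP[g gE]] := Mh i; exists (g, X).
have [|y yE] := @slope_mx_surj _ _ _ _ b (fun i => (gX i).2).
  by move=> i; have [] := gXP i.
exists ([ffun i => ((gX i).1, nonpivot_mx K (b i) *m A i)], y, Y) => i.
rewrite /incidence_mx /= ffunE yE; have [_ <-] := gXP i.
by rewrite mulmxDl mulmxA addrK !mulmxA -mulmxDl pivot_nonpivot_decomp mul1mx.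
Qed.

Lemma common_subspace_hypersurface : (k * (n - k) < total_codim b)%N ->
  exists2 p : entries_poly K m n, p != 0 &
    forall (A : 'I_m -> 'M[K]_n) (h : 'M[K]_(k, n)), S_space c h ->
      (forall i, exists2 M, S_space (b i) M & (M *m A i <= h)%MS) ->
    p.@[entries A] = 0.
Proof.
move=> lt_codim; have dim_lt : (\dim {: incidence_params} < m * n * n)%N.
  by rewrite -(ltn_add2r (total_codim b)) dim_incidence_params ltn_add2l.
have [p p_neq0 p0] :=
  polynomial_image_in_hypersurface polynomial_incidence_mx dim_lt.
exists p => // A h hS Mh; have [v vE] := incidence_mx_cover hS Mh.
by rewrite -[RHS](p0 v); congr (p.@[entries _]); apply/funext => i; rewrite vE.
Qed.

End CommonSubspace.

Lemma open_schubert_hypersurface (b : 'I_m -> schubert_cond n k) :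
    (k * (n - k) < total_codim b)%N ->
  exists2 p : entries_poly K m n, p != 0 &
    forall (F : 'I_m -> flag K n) A H, (forall i, flag_matrix (F i) (A i)) ->
      (forall i, open_schubert (b i) (F i) H) -> p.@[entries A] = 0.
Proof.
move=> lt_codim.
have /choice[p pP] c : exists p : entries_poly K m n, p != 0 /\
    forall (A : 'I_m -> 'M[K]_n) (h : 'M[K]_(k, n)), S_space c h ->
      (forall i, exists2 M, S_space (b i) M & (M *m A i <= h)%MS) ->
    p.@[entries A] = 0.
  by have [p p_neq0 p0] := common_subspace_hypersurface c lt_codim; exists p.
exists (\prod_c p c); first by apply/prodf_neq0 => c _; have [] := pP c.
move=> F A H FA Hb.
have Hk : \dim H = k.
  have [i _|no_i] := pickP (xpredT : pred 'I_m).
    exact: dim_open_schubert (Hb i).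
  by rewrite /total_codim big_pred0 in lt_codim.
have [c [h [hS]]] := rowspace_echelon (unitmx1 K n) Hk; rewrite mulmx1 => HE.
have [_ p0] := pP c; rewrite rmorph_prod (bigD1 c) //= (p0 A h) ?mul0r // => i.
have /(open_schubertP _ _ (FA i))[M MS HM] := Hb i; exists M => //.
by have /rowspace_eq -> : rowspace (M *m A i) = rowspace h by rewrite -HM.
Qed.

End GeneralPosition.

Section GeneralFlags.
Variables (K : fieldType) (n m : nat).
Implicit Types (F : 'I_m -> flag K n) (A L : 'I_m -> 'M[K]_n)
  (p : entries_poly K m n).

Lemma entries_onto (v : 'I_#|{: 'I_m * 'I_n * 'I_n}| -> K) :
  exists A, entries A =1 v.
Proof.
exists (fun i => \matrix_(r, d) v (enum_rank (i, r, d))) => x.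
rewrite /entries; case xE: (enum_val x) => [[i r] d].
by rewrite mxE -xE enum_valK.
Qed.

Definition nonvanishing_flags p : set ('I_m -> flag K n) :=
  [set F | exists2 A, forall i, flag_matrix (F i) (A i) & p.@[entries A] != 0].

Definition translate_poly L p : entries_poly K m n :=
  p \mPo [tuple let: (i, r, d) := enum_val x in
    \sum_l L i r l *: 'X_(enum_rank (i, l, d)) | x < #|{: 'I_m * 'I_n * 'I_n}|].

Lemma meval_translate_poly L p A :
  (translate_poly L p).@[entries A] = p.@[entries (fun i => L i *m A i)].
Proof.
rewrite comp_mpoly_meval; apply: meval_eq => x; rewrite tnth_mktuple /entries.
case: (enum_val x) => [[i r] d]; rewrite mxE linear_sum /=.
by apply: eq_bigr => l _; rewrite mevalZ mevalXU enum_rankK.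
Qed.

(* Two matrices of the same flag differ by a lower triangular factor, so the
   union of the triangular translates of the locus [p <> 0] is saturated. *)
Lemma zariski_open_nonvanishing_flags p : zariski_open (nonvanishing_flags p).
Proof.
exists [set q : entries_poly K m n | forall F A,
  (forall i, flag_matrix (F i) (A i)) ->
  q.@[entries A] != 0 -> nonvanishing_flags p F] => F A FA.
split=> [[A' FA' pA']|[q qU]]; last exact: qU.
have A_unit i : A i \in unitmx by have [] := FA i.
have A'_unit i : A' i \in unitmx by have [] := FA' i.
pose L i := A' i *m invmx (A i); exists (translate_poly L p); last first.
  rewrite meval_translate_poly; suff -> : (fun i => L i *m A i) = A' by [].
  by apply/funext => i; rewrite mulmxKV.
move=> G B GB; rewrite meval_translate_poly => pLB.
exists (fun i => L i *m B i) => // i.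
apply: flag_matrix_trig (GB i) (flag_matrix_trans (FA i) (FA' i)) _.
by rewrite unitmx_mul unitmx_inv A_unit A'_unit.
Qed.

Definition det_poly : entries_poly K m n :=
  \prod_i \det (\matrix_(r, d) 'X_(enum_rank (i, r, d))).

Lemma meval_det_poly A : det_poly.@[entries A] = \prod_i \det (A i).
Proof.
rewrite rmorph_prod; apply: eq_bigr => i _; rewrite -det_map_mx; congr (\det _).
by apply/matrixP => r d; rewrite !mxE /= mevalXU /entries enum_rankK.
Qed.

Lemma det_poly_neq0 : det_poly != 0.
Proof.
apply: contraTneq (oner_neq0 K) => D0; have := meval_det_poly (fun=> 1%:M).
by rewrite D0 meval0 big1 => [<-|i _]; rewrite ?eqxx ?det1.
Qed.

Variables (e : nat -> K) (e_inj : injective e).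

Lemma nonvanishing_flags_neq0 p : p != 0 -> nonvanishing_flags p !=set0.
Proof.
move=> p_neq0.
have [v] := mpoly_nonvanishing e_inj (mulf_neq0 p_neq0 det_poly_neq0).
have [A /meval_eq <-] := entries_onto v.
rewrite mevalM mulf_eq0 negb_or meval_det_poly => /andP[pA /prodf_neq0 detA].
have A_unit i : A i \in unitmx by rewrite unitmxE unitfE detA.
by exists (fun i => rows_flag (A_unit i)), A.
Qed.

Definition properly_intersecting k F : Prop :=
  forall (b : 'I_m -> schubert_cond n k) H,
    (forall i, open_schubert (b i) (F i) H) -> (total_codim b <= k * (n - k))%N.

Lemma general_flags_properly_intersecting k :
  for_general_flags (@properly_intersecting k).
Proof.
have /choice[p pP] (b : {ffun 'I_m -> schubert_cond n k}) :
    exists p : entries_poly K m n, p != 0 /\ ((k * (n - k) < total_codim b)%N ->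
      forall F A H, (forall i, flag_matrix (F i) (A i)) ->
        (forall i, open_schubert (b i) (F i) H) -> p.@[entries A] = 0).
  have [/(open_schubert_hypersurface K)[p p_neq0 p0]|_] := ltnP.
    by exists p.
  by exists 1; rewrite oner_neq0.
exists (nonvanishing_flags (\prod_b p b)); split.
- exact: zariski_open_nonvanishing_flags.
- by apply/nonvanishing_flags_neq0/prodf_neq0 => b _; have [] := pP b.
move=> F [A FA]; rewrite rmorph_prod => /prodf_neq0 pA b H bH.
have bE : [ffun i => b i] = b :> ('I_m -> _).
  by apply/funext => i; rewrite ffunE.
rewrite leqNgt; apply/negP => lt_codim; have /eqP[] := pA [ffun i => b i] isT.
have [_ p0] := pP [ffun i => b i]; rewrite bE in p0.
exact: p0 lt_codim F A H FA bH.
Qed.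

End GeneralFlags.

(* A point of the closed intersection outside the open one would lie in smaller
   open cells, whose codimensions add up to more than [k * (n - k)]. *)
Lemma schubert_problem_open_eq_closed (K : fieldType) n k m
    (F : 'I_m -> flag K n) (a : 'I_m -> schubert_cond n k) :
    (forall i, exists A, flag_matrix (F i) A) -> properly_intersecting k F ->
    schubert_problem a ->
  \bigcap_i open_schubert (a i) (F i) = \bigcap_i schubert_variety (a i) (F i).
Proof.
move=> /choice[A FA] properF aE; apply/seteqP; split=> H HX i _.
  by apply/(open_schubert_variety _ (HX i I)).
have [Hk _] := HX i I.
have /choice[b bH] j := exists_open_schubert (FA j) Hk.
have le_ba j l : (tnth (b j) l <= tnth (a j) l)%N.
  exact: (open_schubert_variety (a j) (bH j)).1 (HX j I) l.
have := properF b H bH; rewrite -aE (geq_leqif (total_codim_leqif le_ba)).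
by move=> /forallP/(_ i)/eqP <-.
Qed.

Theorem theorem5p2p11 (R : realType) (n k m : nat) (k_gt0 : (0 < k)%N)
    (k_lt_n : (k < n)%N) (a : 'I_m.+1 -> schubert_cond n k) :
  for_general_flags (fun F : 'I_m.+1 -> flag (CC R) n =>
    let X := \bigcap_i open_schubert (a i) (F i) in
    forall (F1 : 'M[CC R]_n) (Fhat : 'I_m -> 'M[CC R]_n),
    flag_matrix (F ord0) F1 ->
    (forall i : 'I_m, dual_flag_matrix (F (lift ord0 i)) (Fhat i)) ->
    [/\ set_bij (solutions a F1 Fhat) (dual_diagonal m @` X)
          (subspaces_of F1 Fhat),
        (forall e : eqn_index n k m, bilinear_for *%R *%R (bilin_eqn F1 Fhat e)) /\
        (solutions a F1 Fhat =
           [set x | coordinates a x /\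
              forall e : eqn_index n k m, bilin_eqn F1 Fhat e x.1 (x.2 e.1.1) = 0]),
        #|eqn_index n k m| = (k * (n - k) * m)%N /\
        affine_space_of_dim (@coordinates (CC R) n k m a)
          (k * (n - k) * m.+1 - total_codim a)
      & schubert_problem a ->
        X = \bigcap_i schubert_variety (a i) (F i) /\
        affine_space_of_dim (@coordinates (CC R) n k m a) #|eqn_index n k m|]).
Proof.
have natr_inj : injective (fun i => i%:R : CC R).
  by apply: (@Num.Theory.mulrIn R[i]); apply: oner_neq0.
have [U [U_open U_neq0 U_proper]] :=
  general_flags_properly_intersecting n m.+1 natr_inj k.
exists U; split=> // F /U_proper properF X F1 Fhat FF1 FFhat; split.
- exact: solutions_bij.
- by split=> [e|]; [apply: bilin_eqn_bilinear | apply: solutions_eqns].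
- by split; [apply: card_eqn_index | apply: coordinates_affine].
move=> aE; split; last first.
  by have := coordinates_affine (CC R) a; rewrite aE card_eqn_index mulnS addKn.
apply: schubert_problem_open_eq_closed => // i.
case: (unliftP ord0 i) => [j ->|->].
  by exists (invmx (Fhat j)); apply: dual_flag_matrix_inv.
by exists F1.
Qed.
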